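(* Let $\rho \in (0,1]$. For any scheduling problem (in the sense described in the context) and any instance of it, there exists a valid schedule $S$ with $$C_{\max}(S) \le (1+\rho)\, C^{\rm opt}_{\max} \quad\text{and}\quad \sum_{j=1}^n w_j C_j(S) \le \frac{e^{\rho}}{e^{\rho}-1}\sum_{j=1}^n w_j C_j^*,$$ i.e. a $\left(1+\rho,\ \frac{e^{\rho}}{e^{\rho}-1}\right)$-schedule.
   Context: An instance of a scheduling problem consists of $n$ jobs and $m$ machines, each job $j$ having a non-negative weight $w_j$, together with a notion of valid schedule. A schedule is an assignment of jobs to machines over time and yields a completion time $C_j$ for each job $j$; its makespan is $C_{\max}=\max_j C_j$ and its (weighted) average completion time is $\sum_{j=1}^n w_j C_j$. A ''scheduling problem'' here is any problem whose valid schedules satisfy two conditions: (1) if $S$ is a valid schedule and all jobs completing after some time $t$ are removed from $S$, the result is a valid schedule for the remaining jobs; (2) if $S_1$ and $S_2$ are valid schedules for job sets $J_1$ and $J_2$ (possibly overlapping), then the schedule obtained by appending $S_2$ after the end of $S_1$ and deleting from $S_2$ all jobs of $J_1\cap J_2$ is a valid schedule for $J_1\cup J_2$. $C^{\rm opt}_{\max}$ denotes the minimum makespan over valid schedules and $\sum_j w_j C_j^*$ the minimum weighted completion time over valid schedules (both assumed attained). A schedule $S$ is an $(\alpha,\beta)$-schedule if $C_{\max}(S)\le \alpha C^{\rm opt}_{\max}$ and $\sum_j w_j C_j(S)\le \beta\sum_j w_j C_j^*$. *)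

(* Defs.v *)
From mathcomp Require Import all_boot all_order all_algebra.
From mathcomp Require Import all_classical all_reals all_analysis.

Set Implicit Arguments.
Unset Strict Implicit.
Unset Printing Implicit Defensive.

Import Order.TTheory GRing.Theory Num.Theory.
Import numFieldNormedType.Exports.

Local Open Scope classical_set_scope.
Local Open Scope ring_scope.

(* [S j] is the set of pairs (machine, time) occupied by job [j]. The jobs of
   [S] are those with a nonempty [S j], so a job with zero processing time run
   at time [t] still occupies the point [t]. Preemption, several machines per
   job and overlaps are not excluded: such rules belong to the notion of valid
   schedule of the problem at hand. *)
Definition schedule (R : realType) (n m : nat) : Type :=
  'I_n -> set ('I_m * R).

Section Schedules.
Variables (R : realType) (n m : nat).
Implicit Types (S : schedule R n m) (j : 'I_n) (t : R).

Definition scheduled S j : Prop := S j !=set0.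

Definition proper_schedule S : Prop :=
  forall j, (forall p, S j p -> 0 <= p.2) /\ has_ubound (snd @` S j).

(* [sup set0 = 0], so the jobs that are not in [S] do not affect [makespan]. *)
Definition completion S j : R := sup (snd @` S j).

Definition makespan S : R := \big[Num.max/0]_(j < n) completion S j.

Definition weighted_completion (w : 'I_n -> R) S : R :=
  \sum_(j < n) w j * completion S j.

Definition truncate t S : schedule R n m :=
  fun j => if completion S j <= t then S j else set0.

Definition append S1 S2 : schedule R n m :=
  fun j => if `[< scheduled S1 j >] then S1 j
           else [set (p.1, makespan S1 + p.2) | p in S2 j].

End Schedules.

(* [valid] ranges over schedules of arbitrary subsets of the jobs. *)
Record instance (R : realType) := Instance {
  njobs : nat;
  nmachines : nat;
  weight : 'I_njobs -> R;
  valid : set (schedule R njobs nmachines);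
  weight_ge0 : forall j, 0 <= weight j;
  valid_proper : forall S, valid S -> proper_schedule S
}.

Section Instances.
Variables (R : realType).
Implicit Types (I : instance R).

Definition truncation_closed I : Prop :=
  forall (S : schedule R (njobs I) (nmachines I)) (t : R),
    0 <= t -> valid S -> valid (truncate t S).

Definition append_closed I : Prop :=
  forall S1 S2 : schedule R (njobs I) (nmachines I),
    valid S1 -> valid S2 -> valid (append S1 S2).

(* A problem is given by its collection of instances. *)
Definition scheduling_problem (P : set (instance R)) : Prop :=
  forall I, P I -> truncation_closed I /\ append_closed I.

Definition complete_valid I : set (schedule R (njobs I) (nmachines I)) :=
  [set S | valid S /\ forall j, scheduled S j].
Arguments complete_valid I : clear implicits.

Definition makespans I : set R := [set makespan S | S in complete_valid I].

Definition weighted_completions I : set R :=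
  [set weighted_completion (@weight _ I) S | S in complete_valid I].

(* These are minima when the infimum belongs to the set. *)
Definition opt_makespan I : R := inf (makespans I).

Definition opt_weighted_completion I : R := inf (weighted_completions I).

Definition bicriteria_schedule I (alpha beta : R)
    (S : schedule R (njobs I) (nmachines I)) : Prop :=
  makespan S <= alpha * opt_makespan I /\
  weighted_completion (@weight _ I) S <= beta * opt_weighted_completion I.

End Instances.

Arguments complete_valid {R} I _.

(* Main.v *)
Require Import Defs.
From mathcomp Require Import all_boot all_order all_algebra.
From mathcomp Require Import all_classical all_reals all_analysis.
From mathcomp Require Import ring lra.

Import Order.TTheory GRing.Theory Num.Theory.
Import numFieldNormedType.Exports.

Local Open Scope classical_set_scope.
Local Open Scope ring_scope.

(** Cut an optimal schedule [S*] for the weighted completion time at time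
    [t * L], where [L] is the optimal makespan, and append a schedule of length
    [L]. If [t <= rho] the makespan is at most [(1 + rho) * L], and a job
    completing at [x * L] in [S*] now completes by [cut_cost x t * L]. For [t]
    of density [e^t / (e^rho - 1)] on [[0, rho]] the expectation of
    [cut_cost x t] is at most [e^rho / (e^rho - 1) * x], so some [t] is as good
    as the average. The integral is avoided by the potential
    [t |-> min(t, x) * e^t], a primitive of [cut_cost x t * e^t]: between two
    consecutive values of [x] its increments are controlled by
    [1 + y <= e^y] alone. *)

Definition cut_cost {R : realType} (x t : R) : R :=
  if x <= t then x else 1 + t.

Definition cut_potential {R : realType} (x t : R) : R :=
  Num.min t x * expR t.

(** If [x <= a], both sides equal [x * (expR b - expR a)]. Otherwise [b <= x], and the claim
    rearranges to [(1 + (a - b)) * expR b <= expR a], which is [1 + y <= e^y] at [y = a - b]. *)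
Lemma cut_potential_increment (R : realType) (x a b : R) :
  a <= b -> ~~ (a < x < b) ->
  (expR b - expR a) * cut_cost x a <= cut_potential x b - cut_potential x a.
Proof.
move=> ab nxab; rewrite /cut_cost /cut_potential.
have [xa|ax] := leP x a.
  by rewrite (min_idPr (le_trans xa ab)) le_eqVlt; apply/orP; left; apply/eqP; ring.
have bx : b <= x by move: nxab; rewrite ax /= -leNgt.
rewrite (min_idPl bx).
suff : (1 + (a - b)) * expR b <= expR a by lra.
have -> : expR a = expR (a - b) * expR b by rewrite -expRD subrK.
by rewrite ler_wpM2r ?expR_ge0// expR_ge1Dx.
Qed.

(** Induction along the sorted breakpoints [s]. Since [s] lists every point of [X] between [a] and
    its last entry, no point of [X] lies strictly between consecutive entries. Repeated entries are
    allowed and give trivial steps. *)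
Lemma path_last_lt (R : realType) (X : seq R) (f : R -> R) (s : seq R) (a : R) :
  path <=%R a s ->
  (forall x, x \in X -> a < x -> x \in s \/ last a s <= x) ->
  (forall b c, a <= b -> b < c -> c <= last a s ->
    (forall x, x \in X -> ~~ (b < x < c)) -> f b < f c) ->
  a < last a s -> f a < f (last a s).
Proof.
elim: s a => [|b s IH] a /=; first by rewrite ltxx.
move=> /andP[ab bs] Xs fstep alast.
have b_min : {in b :: s, forall y, b <= y}.
  move=> y; rewrite inE => /predU1P[->//|]; move: y.
  by apply/allP; apply: order_path_min bs; apply: le_trans.
have blast : b <= last b s by apply: b_min; exact: mem_last.
have f_b : b < last b s -> f b < f (last b s).
  move=> lt_b; apply: (IH b) => //.
  - move=> x xX bx; have [|] := Xs x xX (le_lt_trans ab bx); last by right.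
    by rewrite inE => /predU1P[xb|]; [rewrite xb ltxx in bx|left].
  - by move=> c d bc; apply: fstep; apply: le_trans bc.
move: ab; rewrite le_eqVlt => /predU1P[ab|ab].
  by subst b; exact: f_b.
have fab : f a < f b.
  apply: fstep => // x xX; apply/negP => /andP[ax xb].
  have [/b_min|lx] := Xs x xX ax; first by rewrite leNgt xb.
  by move: (le_trans blast lx); rewrite leNgt xb.
move: blast; rewrite le_eqVlt => /predU1P[<-//|/f_b]; exact: lt_trans.
Qed.

(** The points of [X] strictly between [a] and [b], sorted and followed by [b], form a finite chain
    from [a] along which [f] increases. This replaces integration over the pieces. *)
Lemma lt_of_gapwise_lt (R : realType) (X : seq R) (f : R -> R) (a b : R) :
  a < b ->
  (forall c d, a <= c -> c < d -> d <= b ->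
    (forall x, x \in X -> ~~ (c < x < d)) -> f c < f d) ->
  f a < f b.
Proof.
move=> ab fstep.
pose s := rcons (sort <=%R [seq x <- X | a < x < b]) b.
have lb : last a s = b by rewrite last_rcons.
rewrite -lb; apply: (@path_last_lt _ X); rewrite ?lb//.
- rewrite path_sortedE; last exact: le_trans.
  apply/andP; split.
    apply/allP => y; rewrite mem_rcons inE mem_sort mem_filter.
    by move=> /predU1P[->|/andP[/andP[/ltW]]//]; exact: ltW.
  rewrite /s sorted_pairwise ?pairwise_rcons -?sorted_pairwise; try exact: le_trans.
  rewrite (sort_sorted le_total) andbT.
  by apply/allP => y; rewrite mem_sort mem_filter => /andP[/andP[_ /ltW]].
- move=> x xX ax; have [xb|] := ltP x b; last by right.
  by left; rewrite mem_rcons inE mem_sort mem_filter ax xb xX orbT.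
Qed.

Lemma exists_good_cut (R : realType) (n : nat) (w x : 'I_n -> R) (rho : R) :
  0 < rho -> (forall j, 0 <= w j) -> (forall j, 0 <= x j) ->
  exists2 t, 0 <= t <= rho &
    \sum_(j < n) w j * cut_cost (x j) t
      <= expR rho / (expR rho - 1) * \sum_(j < n) w j * x j.
Proof.
move=> rho0 w0 x0; apply: contrapT => no_cut.
set W := \sum_(j < n) w j * x j in no_cut.
set c := _ * W in no_cut.
have cut_gt t : 0 <= t -> t <= rho -> c < \sum_(j < n) w j * cut_cost (x j) t.
  move=> t0 tr; rewrite ltNge; apply/negP => tc.
  by apply: no_cut; exists t; rewrite ?t0.
(* If every cut costs more than [c], this [f] increases strictly across each gap between values of
   [x]: the cost at the left end of the gap already exceeds [c]. *)
pose f t := \sum_(j < n) w j * cut_potential (x j) t - c * expR t.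
have : f 0 < f rho.
  apply: (@lt_of_gapwise_lt _ [seq x j | j <- enum 'I_n]) => // a b a0 ab br Xab.
  rewrite -subr_gt0.
  have eab : 0 < expR b - expR a by rewrite subr_gt0 ltr_expR.
  apply: (@lt_le_trans _ _
    ((expR b - expR a) * (\sum_(j < n) w j * cut_cost (x j) a - c))).
    by rewrite mulr_gt0// subr_gt0 cut_gt// (le_trans (ltW ab)).
  suff : (expR b - expR a) * \sum_(j < n) w j * cut_cost (x j) a <=
    \sum_(j < n) w j * cut_potential (x j) b
    - \sum_(j < n) w j * cut_potential (x j) a by rewrite /f; lra.
  rewrite mulr_sumr -sumrB; apply: ler_sum => j _.
  rewrite mulrCA -mulrBr ler_wpM2l// cut_potential_increment ?(ltW ab)//.
  by apply: Xab; apply: map_f; rewrite mem_enum.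
(* Contradiction: [f 0 = - c], while [f rho <= (W - c) * expR rho = - c] by the choice of [c]. *)
apply/negP; rewrite -leNgt /f.
have -> : \sum_(j < n) w j * cut_potential (x j) 0 = 0.
  by apply: big1 => j _; rewrite /cut_potential (min_idPl (x0 j)) mul0r mulr0.
have : \sum_(j < n) w j * cut_potential (x j) rho <= W * expR rho.
  rewrite /W mulr_suml; apply: ler_sum => j _.
  by rewrite -mulrA ler_wpM2l// ler_wpM2r ?expR_ge0// ge_min lexx orbT.
have e1 : expR rho - 1 != 0 by rewrite gt_eqF// subr_gt0 expR_gt1.
have : c * (expR rho - 1) = W * expR rho by rewrite /c; field.
rewrite expR0; lra.
Qed.

Section Schedules.
Context {R : realType} {n m : nat}.
Implicit Types (S : schedule R n m) (j : 'I_n) (t : R).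

Lemma le_completion S j p : proper_schedule S -> S j p -> p.2 <= completion S j.
Proof. by move=> /(_ j)[_ ubS] Sp; apply: ub_le_sup => //; exists p. Qed.

Lemma completion_ge0 S j : proper_schedule S -> 0 <= completion S j.
Proof.
move=> Sp; have [S0|/set0P[p Sjp]] := eqVneq (S j) set0.
  by rewrite /completion S0 image_set0 sup0.
by apply: le_trans (le_completion _ _ _ Sp Sjp); apply: (Sp j).1.
Qed.

Lemma completion_le_makespan S j : completion S j <= makespan S.
Proof. by rewrite /makespan (le_bigmax _ (completion S)). Qed.

Lemma makespan_ge0 S : 0 <= makespan S.
Proof. exact: bigmax_ge_id. Qed.

Lemma makespan_le S t :
  0 <= t -> (forall j, completion S j <= t) -> makespan S <= t.
Proof. by move=> t0 St; apply: bigmax_le. Qed.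

Lemma makespan_truncate S t : 0 <= t -> makespan (truncate t S) <= t.
Proof.
move=> t0; apply: makespan_le => // j; rewrite /completion /truncate.
(* A removed job has completion time [sup set0 = 0], at most [t] since [0 <= t]. *)
by case: ifPn => // _; rewrite image_set0 sup0.
Qed.

Lemma scheduled_append S1 S2 j :
  scheduled S2 j -> scheduled (append S1 S2) j.
Proof.
rewrite /scheduled /append; case: ifPn => [/asboolP//|_] [p S2p].
by exists (p.1, makespan S1 + p.2); exists p.
Qed.

Lemma completion_append_first S1 S2 j :
  scheduled S1 j -> completion (append S1 S2) j = completion S1 j.
Proof. by move=> S1j; rewrite /completion /append asboolT. Qed.

Lemma completion_append_second S1 S2 j :
  proper_schedule S2 -> ~ scheduled S1 j -> scheduled S2 j ->
  completion (append S1 S2) j <= makespan S1 + makespan S2.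
Proof.
move=> S2P S1j [p S2p]; rewrite {1}/completion /append asboolF//.
apply: ge_sup; first by exists (makespan S1 + p.2), (p.1, makespan S1 + p.2) => //; exists p.
move=> _ [_ [q S2q <-] <-] /=; rewrite lerD2l.
exact: le_trans (le_completion _ _ _ S2P S2q) (completion_le_makespan _ _).
Qed.

(** A job that survives the cut keeps its place. Any other is taken from [S2], which starts at the
    end of the truncated schedule, hence by time [t]. *)
Lemma completion_append_truncate S1 S2 t j :
  0 <= t -> proper_schedule S2 -> scheduled S1 j -> scheduled S2 j ->
  completion (append (truncate t S1) S2) j
    <= if completion S1 j <= t then completion S1 j else t + makespan S2.
Proof.
move=> t0 S2P S1j S2j; case: ifPn => S1t.
  have trE : truncate t S1 j = S1 j by rewrite /truncate S1t.
  by rewrite completion_append_first /scheduled /completion trE.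
apply: le_trans (_ : _ <= makespan (truncate t S1) + makespan S2) _.
  apply: completion_append_second => //.
  by rewrite /scheduled /truncate (negbTE S1t) => -[].
by rewrite lerD2r makespan_truncate.
Qed.

End Schedules.

Theorem mainTheorem1 (R : realType) (rho : R) (rho_gt0 : 0 < rho)
    (rho_le1 : rho <= 1)
    (P : set (instance R)) (P_problem : scheduling_problem P)
    (I : instance R) (PI : P I)
    (opt_makespan_attained : makespans I (opt_makespan I))
    (opt_weighted_completion_attained :
       weighted_completions I (opt_weighted_completion I)) :
  exists S : schedule R (njobs I) (nmachines I),
    complete_valid I S /\
    bicriteria_schedule (1 + rho) (expR rho / (expR rho - 1)) S.
Proof.
have [trI apI] := P_problem _ PI.
case: opt_makespan_attained => SM [SMv SMj] SML.
case: opt_weighted_completion_attained => SW [SWv SWj] SWE.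
rewrite /bicriteria_schedule -SML -SWE.
have SMp := valid_proper SMv; have SWp := valid_proper SWv.
have w0 := @weight_ge0 _ I.
set L := makespan SM; have L0 : 0 <= L by exact: makespan_ge0.
set beta := expR rho / _.
have beta0 : 0 <= beta.
  by rewrite divr_ge0 ?expR_ge0// subr_ge0 ltW// expR_gt1.
(* Times are to be divided by [L]. When [L = 0], every job of [SM] completes at time 0, so [SM]
   itself meets both bounds. *)
have [Lle0|Lgt0] := leP L 0.
  exists SM; split; first by []; split.
    by rewrite ler_peMl// lerDl ltW.
  apply: (@le_trans _ _ 0).
    apply: sumr_le0 => j _; rewrite mulr_ge0_le0//.
    exact: le_trans (completion_le_makespan _ _) Lle0.
  by rewrite mulr_ge0// sumr_ge0// => j _; rewrite mulr_ge0// completion_ge0.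
have [t /andP[t0 tr] tcost] := exists_good_cut _ _ (@weight _ I)
  (fun j => completion SW j / L) _ rho_gt0 w0
  (fun j => divr_ge0 (completion_ge0 _ j SWp) L0).
have tL0 : 0 <= t * L by rewrite mulr_ge0.
have Cle j : completion (append (truncate (t * L) SW) SM) j
    <= cut_cost (completion SW j / L) t * L.
  apply: le_trans (completion_append_truncate _ _ _ _ tL0 SMp (SWj j) (SMj j)) _.
  rewrite /cut_cost ler_pdivrMr//; case: ifPn => _.
    by rewrite divfK ?gt_eqF.
  by rewrite mulrDl mul1r addrC.
exists (append (truncate (t * L) SW) SM); split.
  split; first by apply: apI => //; exact: trI.
  by move=> j; apply: scheduled_append.
split.
  apply: makespan_le => [|j]; first by rewrite mulr_ge0// addr_ge0// ltW.
  apply: le_trans (Cle j) _; rewrite ler_wpM2r// /cut_cost.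
  (* Either branch of the cost is at most [1 + t], hence at most [1 + rho]. *)
  by case: ifPn => [xt|_]; lra.
apply: (@le_trans _ _
  ((\sum_j weight j * cut_cost (completion SW j / L) t) * L)).
  rewrite mulr_suml; apply: ler_sum => j _.
  by rewrite -mulrA ler_wpM2l.
apply: le_trans (ler_wpM2r L0 tcost) _.
rewrite -/beta -mulrA ler_wpM2l// mulr_suml; apply: ler_sum => j _.
by rewrite -mulrA divfK// gt_eqF.
Qed.
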